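(* Fix $\varepsilon>0$. For each $N$ let $E_N$ be an $N\times N$ random matrix with jointly independent zero-mean entries such that $\mathbb{E}\|E_N\|=O(N^{1/2})$. There exists a function $\widehat c_0:(1/2,\infty)\to(0,\infty)$ with $\lim_{\gamma\to1/2}\widehat c_0(\gamma)=0$ and $\lim_{\gamma\to\infty}\gamma^{-1}\widehat c_0(\gamma)=1$ such that, for every fixed $\gamma>1/2$, the following event holds with probability $1-o(1)$ as $N\to\infty$: for every $i\in\{1,\dots,N\}$ such that the eigenvalue $\lambda_i^N$ of $J_N+N^{-\gamma}E_N$ lies in the open disk $\mathbb{D}(0,1-\varepsilon)$, a corresponding right eigenvector $v_i^N$ of unit Euclidean norm satisfies $$\|v_i^N\|_\infty\ge\tfrac12\varepsilon^{1/2}\qquad\text{and}\qquad \big\|(v_i^N)_{[\ell,N]}\big\|\le(1-\varepsilon)^{\ell-1}\ \text{ for all integers }1\le\ell\le\widehat c_0(\gamma)\log N.$$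
   Context: $J_N$ is the $N\times N$ nilpotent Jordan block: ones on the first superdiagonal and zeros elsewhere (the Toeplitz matrix with symbol $\boldsymbol{a}(\zeta)=\zeta^{-1}$). $\lambda_1^N,\dots,\lambda_N^N$ are the eigenvalues of $J_N+N^{-\gamma}E_N$, and $v_i^N$ denotes a right eigenvector for $\lambda_i^N$ with $\|v_i^N\|=1$. $\|\cdot\|$ is the Euclidean norm for vectors and the induced operator norm for matrices; $\|\cdot\|_\infty$ is the $\ell^\infty$ norm. $[\ell,N]$ denotes the index set $\{\ell+1,\ell+2,\dots,N\}$, and $v_I$ is the restriction of the vector $v$ to the coordinates in $I$.
   Formalization: The limit of ĉ₀(γ)/γ being 1 as γ→∞ is asserted only for ε outside (1−1/e, 1); inside that interval it is false, e.g. when E_N has the single nonzero entry ±√N (fair random sign) at position (N−1,1). *)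

(* Defs.v *)
From HB Require Import structures.
From mathcomp Require Import all_boot all_order all_algebra.
From mathcomp Require Import all_classical all_reals all_analysis.
From mathcomp Require Import complex.
Import Order.TTheory GRing.Theory Num.Theory.
Import numFieldNormedType.Exports.

Set Implicit Arguments.
Unset Strict Implicit.
Unset Printing Implicit Defensive.

Local Open Scope classical_set_scope.
Local Open Scope ring_scope.
Local Open Scope complex_scope.

Section LinearAlgebra.
Context {R : realType}.
Implicit Types (z : R[i]) (gamma eps c : R).

(* The norm `|z| of the library takes its values in R[i]; this is the same
   modulus as a real number. *)
Definition cabs z : R := Normc.normc z.

Definition norm2 n (v : 'cV[R[i]]_n) : R :=
  Num.sqrt (\sum_(i < n) cabs (v i 0) ^+ 2).

Definition norminf n (v : 'cV[R[i]]_n) : R :=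
  \big[Num.max/0]_(i < n) cabs (v i 0).

Definition opnorm n (A : 'M[R[i]]_n) : R :=
  sup [set norm2 (A *m v) | v in [set v : 'cV[R[i]]_n | norm2 v <= 1]].

(* The index set [l, n] is {l+1, ..., n} with coordinates numbered from 1; as 'I_n is numbered
   from 0, these are the i with l <= i.  The other coordinates are set to 0,
   which does not change the norm of the restriction. *)
Definition tail n (l : nat) (v : 'cV[R[i]]_n) : 'cV[R[i]]_n :=
  \col_i (if (l <= i)%N then v i 0 else 0).

Definition jordan n : 'M[R[i]]_n := \matrix_(i, j) (j == i.+1 :> nat)%:R.

Definition perturbed_jordan n gamma (E : 'M[R[i]]_n) : 'M[R[i]]_n :=
  jordan n + (n%:R `^ (- gamma))%:C *: E.

(* lam lists the eigenvalues of A with algebraic multiplicity. *)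
Definition spectrum_of n (A : 'M[R[i]]_n) (lam : 'I_n -> R[i]) : Prop :=
  char_poly A = \prod_(i < n) ('X - (lam i)%:P).

(* The library's eigenvalue and eigenspace are about row vectors, hence the
   explicit equation. *)
Definition unit_right_eigenvector n (A : 'M[R[i]]_n) z (v : 'cV[R[i]]_n) :=
  A *m v = z *: v /\ norm2 v = 1.

(* If localized_eigenvectors eps (c0 gamma) holds with high probability for
   every gamma > 1/2, then c0 gamma / gamma --> 1 is possible only for eps
   outside ]1 - 1/e, 1[.  Take E_N with a single nonzero entry, s * sqrt N in row
   N-1 and column 1, s a fair random sign: 0 is an eigenvalue of
   J_N + N^-gamma E_N, its eigenvectors are the multiples of
   e_1 - s N^(1/2-gamma) e_N, and for eps < 1 the bound at
   l = floor (c0 gamma * ln N) forces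
   c0 gamma <= (gamma - 1/2) / - ln (1 - eps). *)
Definition localized_eigenvectors n eps c (A : 'M[R[i]]_n) : Prop :=
  forall lam : 'I_n -> R[i], spectrum_of A lam ->
  forall i : 'I_n, cabs (lam i) < 1 - eps ->
  forall v : 'cV[R[i]]_n, unit_right_eigenvector A (lam i) v ->
    2^-1 * Num.sqrt eps <= norminf v /\
    forall l : nat, (1 <= l)%N -> l%:R <= c * ln n%:R ->
      norm2 (tail l v) <= (1 - eps) ^+ l.-1.

End LinearAlgebra.

Section Probability.
Context {R : realType}.

Definition reim (z : R[i]) : R * R := (complex.Re z, complex.Im z).

Definition complex_rv d (T : measurableType d) (X : T -> R[i]) : Prop :=
  measurable_fun setT (reim \o X).

Definition mutually_independent d (T : measurableType d) (P : probability T R)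
    (I : finType) (X : I -> T -> R[i]) : Prop :=
  forall (J : {set I}) (B : I -> set (R * R)), (forall i, measurable (B i)) ->
    P (\bigcap_(i in [set` J]) (reim \o X i) @^-1` B i) =
    (\prod_(i in J) fine (P ((reim \o X i) @^-1` B i)))%:E.

Definition centered d (T : measurableType d) (P : probability T R)
    (X : T -> R[i]) : Prop :=
  [/\ P.-integrable setT (fun w => (complex.Re (X w))%:E),
      P.-integrable setT (fun w => (complex.Im (X w))%:E),
      ('E_P[fun w => complex.Re (X w)] = 0)%E &
      ('E_P[fun w => complex.Im (X w)] = 0)%E].

Definition random_noise d (T : measurableType d) (P : probability T R) n
    (E : T -> 'M[R[i]]_n) : Prop :=
  [/\ forall i j, complex_rv (fun w => E w i j),
      mutually_independent P (fun (ij : 'I_n * 'I_n) w => E w ij.1 ij.2) &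
      forall i j, centered P (fun w => E w i j)].

(* Probability 1 - o(1) for events not yet known to be measurable: G_N contains
   measurable events whose probabilities tend to 1. *)
Definition with_high_probability (d : nat -> measure_display)
    (T : forall N, measurableType (d N)) (P : forall N, probability (T N) R)
    (G : forall N, set (T N)) : Prop :=
  exists F : forall N, set (T N),
    [/\ forall N, measurable (F N), forall N, F N `<=` G N &
        P N (F N) @[N --> \oo] --> 1%E].

End Probability.

(* Main.v *)
(* Write delta = N^(-gamma).  An eigenvector equation (J + delta E) v = lam v says
   that J v = lam v - r with r = delta E v, that is v_(i+1) = lam v_i - r_i.  Hence
   the norms t_l of the tails of v satisfy t_(l+1) <= |lam| t_l + ||r||, so that
   t_l <= (1 - eps)^l + ||r|| / eps when |lam| <= 1 - eps.  This is at most
   (1 - eps)^(l-1) as long as ||r|| <= eps^2 (1 - eps)^(l-1), and l = 1 forces the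
   first coordinate of v to be large.  By Markov's inequality
   ||r|| <= N^(1/2 - gamma + o(1)) with high probability, which allows
   l <= c ln N for every c with c * (- ln (1 - eps)) < gamma - 1/2. *)

Require Import Defs.
From HB Require Import structures.
From mathcomp Require Import all_boot all_order all_algebra.
From mathcomp Require Import all_classical all_reals all_analysis.
From mathcomp Require Import complex.
From mathcomp Require Import measurable_realfun ring lra.
Import Order.TTheory GRing.Theory Num.Theory.
Import numFieldNormedType.Exports.
Local Open Scope classical_set_scope.
Local Open Scope ring_scope.

Set Implicit Arguments.
Unset Strict Implicit.
Unset Printing Implicit Defensive.

(** * Euclidean, sup and operator norms, tails of vectors, action of the Jordan block *)

Section Norms.
Context (R : realType).
Local Notation C := R[i].

Lemma cabs_ge0 (z : C) : 0 <= cabs z.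
Proof. by case: z => a b; exact: sqrtr_ge0. Qed.

Lemma cabs0 : cabs (0 : C) = 0.
Proof. exact: Normc.normc0. Qed.

Lemma sqr_cabs (z : C) : cabs z ^+ 2 = complex.Re z ^+ 2 + complex.Im z ^+ 2.
Proof. by case: z => a b; rewrite /cabs /= sqr_sqrtr// addr_ge0 ?sqr_ge0. Qed.

Lemma cabsM (x y : C) : cabs (x * y) = cabs x * cabs y.
Proof. exact: Normc.normcM. Qed.

Lemma cabsN (x : C) : cabs (- x) = cabs x.
Proof. exact: normcN. Qed.

Lemma cabsD (x y : C) : cabs (x + y) <= cabs x + cabs y.
Proof. exact: le_normcD. Qed.

Lemma cabs_real (a : R) : 0 <= a -> cabs (a%:C)%C = a.
Proof. by move=> a0; rewrite /cabs /= expr0n addr0 sqrtr_sqr ger0_norm. Qed.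

Lemma cabs_le_ReIm (z : C) : cabs z <= `|complex.Re z| + `|complex.Im z|.
Proof.
rewrite -(@ler_pXn2r _ 2)// ?nnegrE ?cabs_ge0 ?addr_ge0//.
rewrite sqr_cabs sqrrD !real_normK ?num_real//.
by rewrite lerD2r lerDl mulrn_wge0// mulr_ge0.
Qed.

Lemma cabs_sum (I : Type) (s : seq I) (F : I -> C) :
  cabs (\sum_(i <- s) F i) <= \sum_(i <- s) cabs (F i).
Proof.
apply: (big_ind2 (fun x y => cabs x <= y)) => [||//]; first by rewrite cabs0.
by move=> x1 x2 y1 y2 h1 h2; apply: le_trans (cabsD _ _) (lerD h1 h2).
Qed.

Context (n : nat).
Implicit Types u v : 'cV[C]_n.

Lemma norm2_ge0 v : 0 <= norm2 v.
Proof. exact: sqrtr_ge0. Qed.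

Lemma sum_sqr_cabs_ge0 v : 0 <= \sum_(i < n) cabs (v i 0) ^+ 2.
Proof. by apply: sumr_ge0 => i _; exact: sqr_ge0. Qed.

Lemma sqr_norm2 v : norm2 v ^+ 2 = \sum_(i < n) cabs (v i 0) ^+ 2.
Proof. by rewrite sqr_sqrtr// sum_sqr_cabs_ge0. Qed.

Lemma ler_norm2 m (u : 'cV[C]_m) v :
  \sum_(i < m) cabs (u i 0) ^+ 2 <= \sum_(i < n) cabs (v i 0) ^+ 2 ->
  norm2 u <= norm2 v.
Proof. exact: ler_wsqrtr. Qed.

Lemma cabs_le_norm2 v i : cabs (v i 0) <= norm2 v.
Proof.
rewrite -(@ler_pXn2r _ 2)// ?nnegrE ?cabs_ge0 ?norm2_ge0// sqr_norm2.
by rewrite (bigD1 i)//= lerDl sumr_ge0// => j _; exact: sqr_ge0.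
Qed.

Lemma norm2_le_sum v : norm2 v <= \sum_(i < n) cabs (v i 0).
Proof.
rewrite -(@ler_pXn2r _ 2)// ?nnegrE ?norm2_ge0 ?sumr_ge0//; last first.
  by move=> i _; exact: cabs_ge0.
rewrite sqr_norm2 expr2 mulr_suml ler_sum// => i _.
rewrite expr2 ler_wpM2l ?cabs_ge0// (bigD1 i)//= lerDl sumr_ge0// => j _.
exact: cabs_ge0.
Qed.

Lemma norm2Z (a : C) v : norm2 (a *: v) = cabs a * norm2 v.
Proof.
rewrite /norm2; under eq_bigr do rewrite mxE cabsM exprMn.
by rewrite -mulr_sumr sqrtrM ?sqr_ge0// sqrtr_sqr ger0_norm ?cabs_ge0.
Qed.

Lemma norm2N v : norm2 (- v) = norm2 v.
Proof. by rewrite /norm2; under eq_bigr do rewrite mxE cabsN. Qed.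

Lemma norm2_eq0 v : norm2 v = 0 -> v = 0.
Proof.
move=> v0; apply/colP => i; rewrite mxE; apply: Normc.eq0_normc.
by apply/eqP; rewrite eq_le cabs_ge0 andbT -v0 cabs_le_norm2.
Qed.

Lemma norm20 : norm2 (0 : 'cV[C]_n) = 0.
Proof.
by rewrite /norm2 big1 ?sqrtr0// => i _; rewrite mxE cabs0 expr0n.
Qed.

(* Convexity of the square: [(a + b)^2 <= (1 + q/p) a^2 + (1 + p/q) b^2] with
   p and q the norms of the two vectors. *)
Lemma norm2D u v : norm2 (u + v) <= norm2 u + norm2 v.
Proof.
have [/eqP/norm2_eq0->|u0] := boolP (norm2 u == 0); first by rewrite norm20 !add0r.
have [/eqP/norm2_eq0->|v0] := boolP (norm2 v == 0); first by rewrite norm20 !addr0.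
have p0 : 0 < norm2 u by rewrite lt_def u0 norm2_ge0.
have q0 : 0 < norm2 v by rewrite lt_def v0 norm2_ge0.
rewrite -(@ler_pXn2r _ 2)// ?nnegrE ?addr_ge0 ?norm2_ge0//.
set p := norm2 u in u0 p0 *; set q := norm2 v in v0 q0 *.
have -> : (p + q) ^+ 2 = (1 + q / p) * p ^+ 2 + (1 + p / q) * q ^+ 2.
  by field; rewrite u0 v0.
rewrite !sqr_norm2 !mulr_sumr -big_split/= ler_sum// => i _.
rewrite mxE; set a := cabs (u i 0); set b := cabs (v i 0).
have a0 : 0 <= a by exact: cabs_ge0.
have b0 : 0 <= b by exact: cabs_ge0.
apply: (@le_trans _ _ ((a + b) ^+ 2)).
  by rewrite ler_pXn2r// ?nnegrE ?addr_ge0 ?cabs_ge0// cabsD.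
rewrite -subr_ge0.
have -> : (1 + q / p) * a ^+ 2 + (1 + p / q) * b ^+ 2 - (a + b) ^+ 2
    = (q * a - p * b) ^+ 2 / (p * q) by field; rewrite u0 v0.
by rewrite divr_ge0 ?sqr_ge0// mulr_ge0// ltW.
Qed.

Lemma cabs_le_norminf v i : cabs (v i 0) <= norminf v.
Proof. by rewrite /norminf (bigD1 i)//= le_max lexx. Qed.

(** This crude bound serves only to make the set defining [opnorm] bounded. *)
Lemma norm2_mulmx_le_sum (A : 'M[C]_n) v :
  norm2 (A *m v) <= (\sum_i \sum_j cabs (A i j)) * norm2 v.
Proof.
apply: (le_trans (norm2_le_sum _)).
rewrite mulr_suml ler_sum// => i _; rewrite mxE.
apply: (le_trans (cabs_sum _ _)).
rewrite mulr_suml ler_sum// => j _.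
by rewrite cabsM ler_wpM2l ?cabs_ge0// cabs_le_norm2.
Qed.

(** [sup] has the default value 0 on sets without a supremum, so [opnorm] is meaningful only once
    this is known; 0 witnesses nonemptiness. *)
Lemma opnorm_has_sup (A : 'M[C]_n) :
  has_sup [set norm2 (A *m v) | v in [set v : 'cV[C]_n | norm2 v <= 1]].
Proof.
split; first by exists (norm2 (A *m 0)), 0; rewrite //= norm20.
exists (\sum_i \sum_j cabs (A i j)) => _ [v /= v1 <-].
apply: (le_trans (norm2_mulmx_le_sum A v)).
rewrite ler_piMr// sumr_ge0// => i _; rewrite sumr_ge0// => j _.
exact: cabs_ge0.
Qed.

Lemma opnorm_ge0 (A : 'M[C]_n) : 0 <= opnorm A.
Proof.
have [_ ub] := opnorm_has_sup A.
apply: le_trans (ub_le_sup ub _); last by exists 0; rewrite //= norm20.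
exact: norm2_ge0.
Qed.

Lemma norm2_mulmx_le (A : 'M[C]_n) v : norm2 (A *m v) <= opnorm A * norm2 v.
Proof.
have [/eqP/norm2_eq0->|v0] := boolP (norm2 v == 0).
  by rewrite mulmx0 norm20 mulr0.
have p0 : 0 < norm2 v by rewrite lt_def v0 norm2_ge0.
have [_ ub] := opnorm_has_sup A.
rewrite -ler_pdivrMr//.
have := ub_le_sup ub; apply.
exists (((norm2 v)^-1)%:C *: v)%C.
  by rewrite /= norm2Z cabs_real ?invr_ge0 ?norm2_ge0// mulVf.
by rewrite -scalemxAr norm2Z cabs_real ?invr_ge0 ?norm2_ge0// mulrC.
Qed.

Lemma opnorm_le (A : 'M[C]_n) (a : R) : 0 <= a ->
  (forall v, norm2 (A *m v) <= a * norm2 v) -> opnorm A <= a.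
Proof.
move=> a0 h; have [ne _] := opnorm_has_sup A.
apply: ge_sup => // _ [v /= v1 <-].
by apply: le_trans (h v) _; rewrite ler_piMr.
Qed.

Lemma norm2_tail l v :
  norm2 (tail l v) ^+ 2 = \sum_(i < n | (l <= i)%N) cabs (v i 0) ^+ 2.
Proof.
rewrite sqr_norm2 [RHS]big_mkcond; apply: eq_bigr => i _; rewrite mxE.
by case: ifP => // _; rewrite cabs0 expr0n.
Qed.

Lemma norm2_tail_le l v : norm2 (tail l v) <= norm2 v.
Proof.
apply: ler_norm2; apply: ler_sum => i _; rewrite mxE.
by case: ifP => // _; rewrite cabs0 expr0n sqr_ge0.
Qed.

Lemma tailB l u v : tail l (u - v) = tail l u - tail l v.
Proof. by apply/colP => i; rewrite !mxE; case: ifP => //; rewrite subr0. Qed.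

Lemma tailZ l (a : C) v : tail l (a *: v) = a *: tail l v.
Proof. by apply/colP => i; rewrite !mxE; case: ifP => //; rewrite mulr0. Qed.

Lemma tail0 v : tail 0%N v = v.
Proof. by apply/colP => i; rewrite !mxE. Qed.

Lemma jordan_mulmxE v (i j : 'I_n) : j = i.+1 :> nat ->
  (jordan n *m v) i 0 = v j 0.
Proof.
move=> ij; rewrite mxE (bigD1 j)//= mxE ij eqxx mul1r big1 ?addr0// => k kj.
rewrite mxE; case: eqP => [ki|]; last by rewrite mul0r.
by move: kj; rewrite -val_eqE /= ki ij eqxx.
Qed.

End Norms.

(** * Deterministic decay of approximate eigenvectors of the Jordan block *)

Section Pseudoeigenvector.
Context (R : realType) (n : nat).
Implicit Types (v r : 'cV[R[i]]_n) (lam : R[i]) (eps eta : R).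

(** The Jordan block shifts coordinates up by one, so the coordinates of [v] from [l.+1] on reappear
    in [jordan n *m v] from [l] on. *)
Lemma norm2_tail_succ l v :
  norm2 (tail l.+1 v) <= norm2 (tail l (jordan n *m v)).
Proof.
rewrite -(@ler_pXn2r _ 2)// ?nnegrE ?norm2_ge0// !norm2_tail.
case: n v => [|m] v; first by rewrite !big_ord0.
(* Index 0 contributes nothing on the left. On the right the last index is split off and bounded
   below by 0; the remaining terms match one by one. *)
rewrite big_mkcond [leRHS]big_mkcond big_ord_recl big_ord_recr/= add0r.
rewrite -[leLHS]addr0 lerD//; last by case: ifP => // _; exact: sqr_ge0.
apply: ler_sum => i _; rewrite ltnS; case: ifP => // _.
by rewrite (@jordan_mulmxE _ _ _ _ (lift ord0 i)).
Qed.

Lemma norm2_tail_rec lam v r eta l :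
    jordan n *m v = lam *: v - r -> norm2 r <= eta ->
  norm2 (tail l.+1 v) <= cabs lam * norm2 (tail l v) + eta.
Proof.
move=> Jv reta; apply: (le_trans (norm2_tail_succ l v)).
rewrite Jv tailB tailZ; apply: (le_trans (norm2D _ _)).
by rewrite norm2Z norm2N lerD2l (le_trans _ reta)// norm2_tail_le.
Qed.

(** Induction on [l]: [eta / eps] is the fixed point of the map x -> (1 - eps) x + eta that drives
    the tail recursion. *)
Lemma norm2_tail_geom lam v r eps eta l : 0 < eps -> cabs lam <= 1 - eps ->
    jordan n *m v = lam *: v - r -> norm2 r <= eta -> norm2 v = 1 ->
  norm2 (tail l v) <= (1 - eps) ^+ l + eta / eps.
Proof.
move=> e0 le Jv reta v1.
have eta0 : 0 <= eta by apply: le_trans reta; exact: norm2_ge0.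
elim: l => [|l IH]; first by rewrite tail0 v1 expr0 lerDl divr_ge0// ltW.
apply: (le_trans (norm2_tail_rec l Jv reta)).
have -> : (1 - eps) ^+ l.+1 + eta / eps
    = (1 - eps) * ((1 - eps) ^+ l + eta / eps) + eta.
  by rewrite exprS; field; rewrite gt_eqF.
by rewrite lerD2r ler_pM// ?cabs_ge0// norm2_ge0.
Qed.

(** The noise term [eta / eps] is at most [eps * (1 - eps) ^+ l], which is exactly the gap between
    [(1 - eps) ^+ l] and [(1 - eps) ^+ l.+1]. *)
Lemma norm2_tail_pseudoeigenvector lam v r eps eta l :
    0 < eps -> cabs lam <= 1 - eps ->
    jordan n *m v = lam *: v - r -> norm2 r <= eta -> norm2 v = 1 ->
    eta <= eps ^+ 2 * (1 - eps) ^+ l ->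
  norm2 (tail l.+1 v) <= (1 - eps) ^+ l.
Proof.
move=> e0 le Jv reta v1 etal.
apply: (le_trans (norm2_tail_geom _ e0 le Jv reta v1)).
have : eta / eps <= eps * (1 - eps) ^+ l.
  by rewrite ler_pdivrMr// mulrAC -expr2.
by rewrite exprS; lra.
Qed.

End Pseudoeigenvector.

(* The first coordinate is large: the others have norm at most
   [1 - eps + eta <= 1 - eps/2]. *)
Lemma norminf_pseudoeigenvector (R : realType) n (lam : R[i]) (v r : 'cV[R[i]]_n)
    (eps eta : R) :
    0 < eps -> cabs lam <= 1 - eps ->
    jordan n *m v = lam *: v - r -> norm2 r <= eta -> norm2 v = 1 ->
    eta <= eps / 2 ->
  2^-1 * Num.sqrt eps <= norminf v.
Proof.
case: n => [|m] in v r *; move=> e0 le Jv reta v1 etae.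
  by move: v1; rewrite /norm2 big_ord0 sqrtr0 => /esym/eqP; rewrite oner_eq0.
have eps1 : eps <= 1 by rewrite -subr_ge0 (le_trans _ le)// cabs_ge0.
apply: le_trans (cabs_le_norminf v ord0).
rewrite -(@ler_pXn2r _ 2)// ?nnegrE ?cabs_ge0 ?mulr_ge0 ?sqrtr_ge0//.
rewrite exprMn sqr_sqrtr ?ltW//.
have t1 : norm2 (tail 1%N v) <= 1 - eps / 2.
  by apply: (le_trans (norm2_tail_rec 0%N Jv reta)); rewrite tail0 v1; lra.
(* By Pythagoras the squared first coordinate is at least 1 - (1 - eps/2)^2 = eps - eps^2/4, which
   exceeds eps/4 because eps <= 1. *)
have : cabs (v ord0 0) ^+ 2 + norm2 (tail 1%N v) ^+ 2 = 1.
  rewrite norm2_tail -[RHS](expr1n _ 2) -v1 sqr_norm2 [RHS]big_ord_recl.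
  by rewrite [in LHS]big_mkcond [in LHS]big_ord_recl/= add0r.
have : norm2 (tail 1%N v) ^+ 2 <= (1 - eps / 2) ^+ 2.
  by rewrite ler_pXn2r// ?nnegrE ?norm2_ge0//; lra.
by nra.
Qed.

(** * Testing the operator norm on countably many vectors *)

Section RationalVectors.
Context (R : realType) (n : nat).

(** The index type is countable, which later turns a supremum over all vectors into a countable
    union of events. *)
Definition rational_vector (q : 'cV[rat * rat]_n) : 'cV[R[i]]_n :=
  \col_j Complex (ratr (q j 0).1) (ratr (q j 0).2).

Lemma ratr_approx (x e : R) : 0 < e -> exists q : rat, `|x - ratr q| <= e.
Proof.
move=> e0; have /rat_in_itvoo[q] : x < x + e by rewrite ltrDl.
rewrite in_itv/= => /andP[xq qx]; exists q.
by rewrite distrC gtr0_norm ?subr_gt0// lerBlDl ltW.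
Qed.

Lemma rational_vector_dense (v : 'cV[R[i]]_n) (e : R) : 0 < e ->
  exists q, norm2 (v - rational_vector q) <= e.
Proof.
(* The error is shared among the coordinates, half for each of the real and imaginary parts; [n.+1]
   avoids dividing by zero when [n] is 0. *)
move=> e0; pose e' := e / n.+1%:R / 2.
have e'0 : 0 < e' by rewrite !divr_gt0.
have /choice[q1 q1P] : forall j, exists q, `|complex.Re (v j 0) - ratr q| <= e'.
  by move=> j; exact: ratr_approx.
have /choice[q2 q2P] : forall j, exists q, `|complex.Im (v j 0) - ratr q| <= e'.
  by move=> j; exact: ratr_approx.
exists (\col_j (q1 j, q2 j)); apply: (le_trans (norm2_le_sum _)).
have : \sum_(j < n) (e / n.+1%:R) <= e.
  rewrite sumr_const card_ord -[leLHS]mulr_natr mulrAC -mulrA ler_piMr ?ltW//.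
  by rewrite ltr_pdivrMr// mul1r ltr_nat.
apply: le_trans; apply: ler_sum => j _.
rewrite !mxE/=; apply: (le_trans (cabs_le_ReIm _)).
move: (q1P j) (q2P j); case: (v j 0) => a b /= h1 h2.
by rewrite (le_trans (lerD h1 h2))// /e' -splitr.
Qed.

(** Both sides are Lipschitz in [v], with constants [opnorm A] and [a], so the inequality passes
    from a dense set to all vectors. *)
Lemma norm2_mulmx_le_rational (A : 'M[R[i]]_n) (a : R) : 0 <= a ->
    (forall q, norm2 (A *m rational_vector q) <= a * norm2 (rational_vector q)) ->
  forall v, norm2 (A *m v) <= a * norm2 v.
Proof.
move=> a0 h v; apply/ler_addgt0Pr => e e0.
(* Replacing [v] by a rational vector costs at most [opnorm A + a] times their distance; the extra 1
   keeps the divisor positive. *)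
have K0 : 0 < opnorm A + a + 1 by rewrite ltr_wpDl// addr_ge0 ?opnorm_ge0.
have [q qe] := rational_vector_dense v (divr_gt0 e0 K0).
set w := rational_vector q in qe.
have hv : norm2 w <= norm2 v + norm2 (v - w).
  by rewrite -[in leLHS](subKr v w) (le_trans (norm2D _ _))// norm2N.
have hA : norm2 (A *m v) <= norm2 (A *m w) + opnorm A * norm2 (v - w).
  rewrite -[in leLHS](subrK w v) mulmxDr addrC (le_trans (norm2D _ _))//.
  by rewrite lerD2l norm2_mulmx_le.
have : (opnorm A + a + 1) * norm2 (v - w) <= e by rewrite mulrC -ler_pdivlMr.
have : a * norm2 w <= a * (norm2 v + norm2 (v - w)) by rewrite ler_wpM2l.
have := h q; rewrite -/w; have := norm2_ge0 (v - w).
by move: hA; rewrite !mulrDr !mulrDl mul1r; lra.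
Qed.

Lemma opnorm_gtP (A : 'M[R[i]]_n) (a : R) : 0 <= a ->
  a < opnorm A <->
  exists q, a * norm2 (rational_vector q) < norm2 (A *m rational_vector q).
Proof.
move=> a0; split=> [|[q aq]].
  apply: contraPP => /forallNP h; apply/negP; rewrite -leNgt.
  apply: opnorm_le => //; apply: norm2_mulmx_le_rational => // q.
  by have /negP := h q; rewrite -leNgt.
rewrite ltNge; apply/negP => Aa; move: aq; apply/negP; rewrite -leNgt.
by apply: (le_trans (norm2_mulmx_le _ _)); rewrite ler_wpM2r ?norm2_ge0.
Qed.

End RationalVectors.

(** * Measurability of the operator norm and Markov's inequality *)

Section Measurability.
Context (R : realType) d (T : measurableType d).
Implicit Types X Y : T -> R[i].

Lemma complex_rvP X : complex_rv X <->
  measurable_fun setT (fun w => complex.Re (X w)) /\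
  measurable_fun setT (fun w => complex.Im (X w)).
Proof. by split=> [/measurable_fun_pairP|?]//; exact/measurable_fun_pairP. Qed.

Lemma complex_rv_cst (z : R[i]) : complex_rv (fun _ : T => z).
Proof. by apply/complex_rvP; split; exact: measurable_cst. Qed.

Lemma complex_rvD X Y : complex_rv X -> complex_rv Y ->
  complex_rv (fun w => X w + Y w).
Proof.
move=> /complex_rvP[Xr Xi] /complex_rvP[Yr Yi]; apply/complex_rvP; split.
- rewrite [X in measurable_fun _ X](_ : _ = (fun w => complex.Re (X w)) \+
    (fun w => complex.Re (Y w))); first exact: measurable_funD.
  by apply/funext => w /=; case: (X w) (Y w) => ? ? [].
- rewrite [X in measurable_fun _ X](_ : _ = (fun w => complex.Im (X w)) \+
    (fun w => complex.Im (Y w))); first exact: measurable_funD.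
  by apply/funext => w /=; case: (X w) (Y w) => ? ? [].
Qed.

Lemma complex_rvMr X (z : R[i]) : complex_rv X -> complex_rv (fun w => X w * z).
Proof.
case: z => a b /complex_rvP[Xr Xi]; apply/complex_rvP; split.
- rewrite [X in measurable_fun _ X](_ : _ =
    (fun w => complex.Re (X w) * a) \- (fun w => complex.Im (X w) * b)).
    by apply: measurable_funB; exact: measurable_funM.
  by apply/funext => w /=; case: (X w).
- rewrite [X in measurable_fun _ X](_ : _ =
    (fun w => complex.Re (X w) * b) \+ (fun w => complex.Im (X w) * a)).
    by apply: measurable_funD; exact: measurable_funM.
  by apply/funext => w /=; case: (X w).
Qed.

Lemma complex_rv_sum (I : Type) (s : seq I) (X : I -> T -> R[i]) :
  (forall i, complex_rv (X i)) -> complex_rv (fun w => \sum_(i <- s) X i w).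
Proof.
move=> h; elim: s => [|i s IH].
  by under eq_fun do rewrite big_nil; exact: complex_rv_cst.
by under eq_fun do rewrite big_cons; exact: complex_rvD.
Qed.

Lemma measurable_norm2 m (u : T -> 'cV[R[i]]_m) :
  (forall i, complex_rv (fun w => u w i 0)) ->
  measurable_fun setT (fun w => norm2 (u w)).
Proof.
move=> h; rewrite (_ : (fun w => norm2 (u w)) =
    Num.sqrt \o (fun w => \sum_(i < m) cabs (u w i 0) ^+ 2))//.
apply: measurableT_comp.
  exact: (@continuous_measurable_fun R _ (@sqrt_continuous R)).
apply: measurable_sum => i; under eq_fun do rewrite sqr_cabs.
have /complex_rvP[hr hi] := h i.
by apply: measurable_funD; exact: measurable_funX.
Qed.

(** Open upper half-lines generate the Borel sets, and by [opnorm_gtP] their preimages are countable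
    unions of events comparing two measurable norms. *)
Lemma measurable_opnorm n (E : T -> 'M[R[i]]_n) :
  (forall i j, complex_rv (fun w => E w i j)) ->
  measurable_fun setT (fun w => opnorm (E w)).
Proof.
move=> h; apply: (measurability _ (RGenOInfty.measurableE R)) => //.
move=> /= _ [_ [a ->] <-]; rewrite setTI.
(* For negative [a] the preimage is the whole space; [opnorm_gtP] handles nonnegative [a]. *)
have [a0|a0] := leP 0 a; last first.
  rewrite (_ : _ @^-1` _ = setT)//; apply/seteqP; split=> // w _ /=.
  by rewrite in_itv/= andbT (lt_le_trans a0)// opnorm_ge0.
rewrite (_ : _ @^-1` _ = \bigcup_q [set w | a * norm2 (rational_vector R q) <
    norm2 (E w *m rational_vector R q)]); last first.
  apply/seteqP; split=> w /=; rewrite in_itv/= andbT.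
    by move=> /(opnorm_gtP _ a0)[q hq]; exists q.
  by move=> [q _ hq]; apply/(opnorm_gtP _ a0); exists q.
apply: countable_bigcupT_measurable => // q.
rewrite (_ : [set w | _] = ~` [set w | norm2 (E w *m rational_vector R q) <=
    a * norm2 (rational_vector R q)]); last first.
  by apply/seteqP; split=> w /=; rewrite ltNge => /negP.
apply: measurableC; rewrite -[X in measurable X]setTI.
apply: measurable_fun_le => //.
apply: measurable_norm2 => i; under eq_fun do rewrite mxE.
by apply: complex_rv_sum => j; exact: complex_rvMr.
Qed.

Lemma markov_opnorm (P : probability T R) n (E : T -> 'M[R[i]]_n) (a c : R) :
    (forall i j, complex_rv (fun w => E w i j)) -> 0 < a ->
    ('E_P[fun w => opnorm (E w)] <= c%:E)%E ->
  measurable [set w | (opnorm (E w) <= a)%R] /\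
  ((1 - c / a)%R%:E <= P [set w | (opnorm (E w) <= a)%R])%E.
Proof.
move=> /measurable_opnorm mE a0 hE.
have mF : measurable [set w | (opnorm (E w) <= a)%R].
  by rewrite -[X in measurable X]setTI; exact: measurable_fun_le.
split=> //.
have mX : measurable_fun setT (fun w => (opnorm (E w))%:E) by exact/measurable_EFinP.
have := le_integral_abse P measurableT mX a0.
rewrite setTI (_ : \int[P]_x _ = 'E_P[fun w => opnorm (E w)])%E; last first.
  by rewrite unlock; apply: eq_integral => w _; rewrite gee0_abs// lee_fin opnorm_ge0.
move=> /le_trans/(_ hE) hP.
have mC : P (~` [set w | (opnorm (E w) <= a)%R]) =
    (1 - P [set w | (opnorm (E w) <= a)%R])%E.
  exact: probability_setC.
(* Markov's inequality bounds the event with a large inequality, which contains this complement. *)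
have : (a%:E * P (~` [set w | (opnorm (E w) <= a)%R]) <= c%:E)%E.
  apply: le_trans hP; rewrite lee_pmul2l//; apply: le_measure; rewrite ?inE.
  - exact: measurableC.
  - rewrite -[X in measurable X]setTI; apply: measurable_lee => //.
    by apply: measurableT_comp.
  - move=> w /= /negP; rewrite -ltNge => h.
    by rewrite lee_fin ger0_norm ?opnorm_ge0// ltW.
rewrite mC -(fineK (fin_num_measure P _ mF)).
by rewrite -EFinB -EFinM !lee_fin mulrC -ler_pdivlMr//; lra.
Qed.

End Measurability.

(** * The localization constant and its limits *)

Section Constant.
Context (R : realType).
Implicit Types eps gamma : R.

(** Chosen so that [gamma - 2^-1] splits as [slack gamma * gamma + slack gamma]: the first part pays
    for the decay of the tails, and the second is halved between the loss in Markov's inequality and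
    a factor tending to 0. It vanishes at 1/2 and tends to 1 at infinity. *)
Definition slack gamma : R := (gamma - 2^-1) / (gamma + 1).

(** The maximum dominates the true rate [- ln (1 - eps)], stays positive, and equals 1 for the [eps]
    at which the limit of [loc_const eps gamma / gamma] must be 1. *)
Definition decay_rate eps : R := Num.max 1 (- ln (1 - eps)).

Definition loc_const eps gamma : R := slack gamma * gamma / decay_rate eps.

Lemma slack_gt0 gamma : 2^-1 < gamma -> 0 < slack gamma.
Proof. by move=> g; rewrite divr_gt0//; lra. Qed.

Lemma decay_rate_gt0 eps : 0 < decay_rate eps.
Proof. by rewrite lt_max ltr01. Qed.

Lemma decay_rate_eq1 eps : ~~ (1 - expR (-1) < eps < 1) -> decay_rate eps = 1.
Proof.
(* When [eps] is at least 1, [ln] takes its default value 0 at [1 - eps]. *)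
move=> h; apply/max_idPl; have [e1|e1] := ltP eps 1; last first.
  by rewrite ln0 ?oppr0// subr_le0.
have : eps <= 1 - expR (-1) by move: h; rewrite e1 andbT -leNgt.
move=> le_eps; rewrite lerNl -[leLHS]expRK ler_ln ?posrE ?expR_gt0 ?subr_gt0//.
by lra.
Qed.

Lemma loc_const_gt0 eps gamma : 2^-1 < gamma -> 0 < loc_const eps gamma.
Proof.
move=> g; rewrite divr_gt0 ?decay_rate_gt0// mulr_gt0 ?slack_gt0//; lra.
Qed.

Lemma loc_const_cvg0 eps : loc_const eps gamma @[gamma --> 2^-1^'+] --> 0.
Proof.
apply: cvg_at_right_filter.
have -> : 0 = (2^-1 - 2^-1) / (2^-1 + 1) * 2^-1 / decay_rate eps :> R.
  by rewrite subrr !mul0r.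
apply: cvgM; last exact: cvg_cst.
apply: cvgM; last exact: cvg_id.
apply: cvgM; first by apply: cvgB; [exact: cvg_id|exact: cvg_cst].
apply: cvgV; first by rewrite gt_eqF// addr_gt0// invr_gt0.
by apply: cvgD; [exact: cvg_id|exact: cvg_cst].
Qed.

Lemma loc_const_cvg1 eps : ~~ (1 - expR (-1) < eps < 1) ->
  gamma^-1 * loc_const eps gamma @[gamma --> +oo] --> (1 : R).
Proof.
move=> /decay_rate_eq1 rate1; apply/cvgrPdist_le => e e0; near=> g.
have g0 : 0 < g by near: g; exact: nbhs_pinfty_gt.
have ge : 2 / e <= g by near: g; apply: nbhs_pinfty_ge; exact: num_real.
(* With rate 1 the ratio is just [slack g], whose distance to 1 is explicit and below [e] once [g]
   is at least [2 / e]. *)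
have -> : 1 - g^-1 * loc_const eps g = (3 / 2) / (g + 1).
  rewrite /loc_const /slack rate1; field.
  by rewrite !gt_eqF//; lra.
rewrite ger0_norm; last by rewrite divr_ge0//; lra.
by rewrite ler_pdivrMr; [move: ge; rewrite ler_pdivrMr//; nra|lra].
Unshelve. all: by end_near. Qed.

Lemma powR_opp_cvg0 (t : R) : 0 < t -> (n%:R `^ (- t)) @[n --> \oo] --> (0 : R).
Proof.
move=> t0; apply/cvgrPdist_le => e e0; near=> n.
have n0 : (0 < n)%N by near: n; exact: nbhs_infty_gt.
have ne : (e^-1) `^ t^-1 <= n%:R by near: n; exact: nbhs_infty_ger.
rewrite sub0r normrN ger0_norm ?powR_ge0// powRN.
rewrite invf_ple ?posrE ?powR_gt0 ?ltr0n//.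
have -> : e^-1 = (e^-1 `^ t^-1) `^ t.
  by rewrite -powRrM mulVf ?gt_eqF// powRr1// invr_ge0 ltW.
by apply: ge0_ler_powR; rewrite ?nnegrE ?powR_ge0 ?(ltW t0).
Unshelve. all: by end_near. Qed.

End Constant.

(** * Localization for a noise matrix of controlled norm *)

Section Localization.
Context (R : realType).

(** Threshold for Markov's inequality: the expected order of the norm, enlarged by a small power of
    [n]. *)
Definition noise_level (gamma : R) (n : nat) : R :=
  n%:R `^ (slack gamma / 2) * Num.sqrt n%:R.

(** Comparing exponents, this is the identity [slack gamma * (gamma + 1) = gamma - 2^-1]. *)
Lemma scaled_noise_level (gamma : R) n : (0 < n)%N -> 2^-1 < gamma ->
  n%:R `^ (- gamma) * noise_level gamma n =
  n%:R `^ (- (slack gamma / 2)) * n%:R `^ (- (slack gamma * gamma)).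
Proof.
move=> n0 g; have nz : n%:R != 0 :> R by rewrite pnatr_eq0 -lt0n.
rewrite /noise_level -powR12_sqrt// -!powRD ?nz ?implybT//.
congr powR; rewrite /slack; field; lra.
Qed.

(** After taking logarithms, [l * - ln (1 - eps)] is at most [l * decay_rate eps], hence at most
    [slack gamma * gamma * ln n]. *)
Lemma decay_rate_pow (eps gamma : R) n l : (0 < n)%N -> 0 < eps < 1 ->
    l%:R <= loc_const eps gamma * ln n%:R ->
  n%:R `^ (- (slack gamma * gamma)) <= (1 - eps) ^+ l.
Proof.
move=> n0 /andP[e0 e1] hl; rewrite /powR pnatr_eq0 eqn0Ngt n0 /=.
rewrite -[in leRHS](@lnK _ (1 - eps)) ?posrE ?subr_gt0// -expRM_natl ler_expR.
rewrite mulNr lerNl -mulrN.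
apply: (@le_trans _ _ (l%:R * decay_rate eps)).
  by rewrite ler_wpM2l// le_max lexx orbT.
by rewrite -ler_pdivlMr ?decay_rate_gt0// mulrAC.
Qed.

Lemma localized_eigenvectors_perturbed_jordan (eps gamma : R) n (E : 'M[R[i]]_n) :
    0 < eps -> 2^-1 < gamma -> opnorm E <= noise_level gamma n ->
    n%:R `^ (- (slack gamma / 2)) <= eps ^+ 2 / 2 ->
  localized_eigenvectors eps (loc_const eps gamma) (perturbed_jordan gamma E).
Proof.
move=> e0 g En small lam _ i lami v [Av v1].
have n0 : (0 < n)%N by case: n i {E En small lam lami v Av v1} => [[]|].
(* An eigenvalue in the open disk forces its radius to be positive. *)
have e1 : eps < 1 by rewrite -subr_gt0 (le_lt_trans _ lami)// cabs_ge0.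
pose r := ((n%:R `^ (- gamma))%:C)%C *: (E *m v).
have Jv : jordan n *m v = lam i *: v - r.
  by rewrite -Av /perturbed_jordan mulmxDl -scalemxAl addrK.
pose eta := n%:R `^ (- (slack gamma / 2)) * n%:R `^ (- (slack gamma * gamma)).
have reta : norm2 r <= eta.
  rewrite /eta -scaled_noise_level// norm2Z cabs_real ?powR_ge0//.
  rewrite ler_wpM2l ?powR_ge0//; apply: (le_trans (norm2_mulmx_le _ _)).
  by rewrite v1 mulr1.
have etapow l : l%:R <= loc_const eps gamma * ln n%:R ->
    eta <= eps ^+ 2 / 2 * (1 - eps) ^+ l.
  by move=> hl; apply: ler_pM; rewrite ?powR_ge0// decay_rate_pow// e0.
have lami' := ltW lami.
split.
  apply: (norminf_pseudoeigenvector e0 lami' Jv reta v1).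
  apply: (@le_trans _ _ (eps ^+ 2 / 2)); last first.
    by rewrite ler_pM2r ?invr_gt0// expr2 ler_piMl ?(ltW e0) ?(ltW e1).
  (* At exponent 0 the power is 1, leaving [eta <= eps ^+ 2 / 2]. *)
  rewrite -[leRHS]mulr1; apply: etapow 0%N _.
  by rewrite mulr_ge0 ?ln_ge0 ?ler1n// ltW// loc_const_gt0.
case=> // l _ hl; apply: (norm2_tail_pseudoeigenvector e0 lami' Jv reta v1).
(* The hypothesis concerns [l.+1], so [etapow] yields one more factor [1 - eps] than required; this
   factor and the 1/2 are at most 1. *)
apply: (le_trans (etapow _ hl)); rewrite [(1 - eps) ^+ _]exprS.
have : 0 <= (1 - eps) ^+ l by rewrite exprn_ge0// subr_ge0 ltW.
set b := (1 - eps) ^+ l => b0; have := sqr_ge0 eps => e20.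
by apply: ler_pM; rewrite ?mulr_ge0 ?ler_piMl ?subr_ge0 ?invr_ge0 ?(ltW e1)//; lra.
Qed.

End Localization.

(** * Events of high probability and conclusion *)

Theorem theorem2p27 (R : realType) (eps : R) (heps : 0 < eps)
  (d : nat -> measure_display) (T : forall N, measurableType (d N))
  (P : forall N, probability (T N) R)
  (E : forall N, T N -> 'M[R[i]]_N)
  (hE : forall N, random_noise (P N) (E N))
  (hEnorm : exists C : R, \forall N \near \oo,
     ('E_(P N)[fun w => opnorm (E N w)] <= (C * Num.sqrt N%:R)%:E)%E) :
  exists c0 : R -> R,
    [/\ forall gamma, 2^-1 < gamma -> 0 < c0 gamma,
        c0 gamma @[gamma --> 2^-1^'+] --> 0,
        (~~ (1 - expR (-1) < eps < 1) ->
          gamma^-1 * c0 gamma @[gamma --> +oo] --> (1 : R)) &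
        forall gamma, 2^-1 < gamma ->
          with_high_probability P (fun N =>
            [set w | localized_eigenvectors eps (c0 gamma)
                       (perturbed_jordan gamma (E N w))])].
Proof.
have [C hC] := hEnorm.
exists (loc_const eps); split.
- by move=> gamma; exact: loc_const_gt0.
- exact: loc_const_cvg0.
- exact: loc_const_cvg1.
move=> gamma g.
have s0 : 0 < slack gamma / 2 by rewrite divr_gt0// slack_gt0.
have mE N : forall i j, complex_rv (fun w => E N w i j) by case: (hE N).
pose small N := (0 < N)%N && (N%:R `^ (- (slack gamma / 2)) <= eps ^+ 2 / 2).
(* The inclusion in the localization event must hold for every [N], so [F N] is empty while [N] is
   too small for the deterministic lemma; [small N] holds eventually. *)
pose F N := if small N then [set w | opnorm (E N w) <= noise_level gamma N] else set0.
have level_gt0 N : (0 < N)%N -> 0 < noise_level gamma N.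
  by move=> N0; rewrite mulr_gt0 ?powR_gt0 ?sqrtr_gt0 ?ltr0n.
have mF N : measurable (F N).
  rewrite /F; case: ifP => // /andP[N0 _].
  rewrite -[X in measurable X]setTI; apply: measurable_fun_le => //.
  exact: measurable_opnorm.
exists F; split=> //.
  move=> N w; rewrite /F; case: ifP => // /andP[_ sm] /= Ew.
  exact: localized_eigenvectors_perturbed_jordan.
apply: (@squeeze_cvge _ _ _ _ (fun N => (1 - C * N%:R `^ (- (slack gamma / 2)))%:E)
  _ (fun _ => 1%E)).
- near=> N.
  have N0 : (0 < N)%N by near: N; exact: nbhs_infty_gt.
  have sm : small N.
    rewrite /small N0/=; near: N.
    have e2 : 0 < eps ^+ 2 / 2 by rewrite divr_gt0// exprn_gt0.
    apply: cvgr_le e2; exact: powR_opp_cvg0.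
  rewrite probability_le1 ?andbT//.
  have hN : ('E_(P N)[fun w => opnorm (E N w)] <= (C * Num.sqrt N%:R)%:E)%E.
    by near: N.
  have [_] := markov_opnorm (mE N) (level_gt0 N N0) hN.
  (* In the Markov quotient the square roots of [N] cancel, leaving [C] times a negative power of
     [N]. *)
  rewrite /F sm; apply: le_trans; rewrite lee_fin lerD2l lerN2.
  rewrite /noise_level powRN invfM mulrACA mulfV ?mulr1//.
  by rewrite gt_eqF// sqrtr_gt0 ltr0n.
- apply: cvg_EFin.
    by near=> N.
  rewrite -[X in _ --> X]subr0 -(mulr0 C).
  apply: cvgB; first exact: cvg_cst.
  by apply: cvgM; [exact: cvg_cst|exact: powR_opp_cvg0].
- exact: cvg_cst.
Unshelve. all: by end_near. Qed.
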